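(* Let $H$ be a separable, infinite dimensional real Hilbert space and let $C\subseteq H$ be a closed, convex, somewhat bounded set. Then there is a dense open set $\mathcal{R}\subseteq\mathcal{N}(C)$ such that every $f\in\mathcal{R}$ has a fixed point.
   Context: For a subset $C$ of a Hilbert space $H$ with norm $\|\cdot\|$, $\mathcal{N}(C)$ denotes the set of all nonexpansive mappings $f\colon C\to C$, i.e. mappings with $\|f(x)-f(y)\|\le\|x-y\|$ for all $x,y\in C$. It is endowed with the topology of pointwise convergence, i.e. the coarsest topology containing all sets $\{g\in\mathcal{N}(C): \|g(x)-f(x)\|<\varepsilon\}$ with $f\in\mathcal{N}(C)$, $x\in C$, $\varepsilon>0$. A nonempty, non-singleton convex set $C$ in an infinite dimensional Hilbert space $H$ is called somewhat bounded if there are $x_0\in C$, a finite dimensional subspace $F\subseteq H$ and $\alpha>0$ such that $\alpha B_F\subseteq C-x_0$ and $F^\perp\cap(C-x_0)$ is bounded. Here $B_F$ is the closed unit ball of $F$ and $F^\perp$ the orthogonal complement of $F$ in $H$. *)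

(* Defs.v *)
From HB Require Import structures.
From mathcomp Require Import all_boot all_order all_algebra sesquilinear.
From mathcomp Require Import all_classical all_reals all_analysis.

Set Implicit Arguments.
Unset Strict Implicit.
Unset Printing Implicit Defensive.

Import Order.TTheory GRing.Theory Num.Theory.
Import numFieldNormedType.Exports.

Local Open Scope classical_set_scope.
Local Open Scope ring_scope.

(* A real Hilbert space is a complete normed module H together with a positive
   definite symmetric bilinear form that induces the norm of H. *)
Definition induces_norm (R : realType) (H : normedModType R)
    (dot : {dot H for idfun}) : Prop :=
  forall x : H, dot x x = `|x| ^+ 2.

Definition separable (T : topologicalType) : Prop :=
  exists D : set T, countable D /\ dense D.

Definition lin_span (R : realType) (H : lmodType R) n (v : 'I_n -> H) : set H :=
  [set \sum_(i < n) c i *: v i | c in [set: 'I_n -> R]].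

Definition findim_subspace (R : realType) (H : lmodType R) (F : set H) : Prop :=
  exists n (v : 'I_n -> H), F = lin_span v.

Definition infinite_dimensional (R : realType) (H : lmodType R) : Prop :=
  ~ findim_subspace [set: H].

Definition orth_compl (R : realType) (H : lmodType R)
    (dot : {dot H for idfun}) (F : set H) : set H :=
  [set x | forall y, F y -> dot x y = 0].

Definition somewhat_bounded (R : realType) (H : normedModType R)
    (dot : {dot H for idfun}) (C : set H) : Prop :=
  [/\ C !=set0, ~ (exists x, C = [set x]), convex_set C &
    exists (x0 : H) (F : set H) (alpha : R),
      let C0 := [set x - x0 | x in C] in
      [/\ C x0, findim_subspace F, 0 < alpha,
          [set alpha *: b | b in F `&` [set b | `|b| <= 1]] `<=` C0 &
          bounded_set (orth_compl dot F `&` C0)]].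

(* As a type, nonexpansive_maps C carries the subspace topology of
   {ptws C -> C}, where C has the norm topology inherited from H. *)
Definition nonexpansive_maps (R : realType) (H : normedModType R) (C : set H) :
    set {ptws C -> C} :=
  [set f | forall x y : C,
    `|set_val (f x) - set_val (f y)| <= `|set_val x - set_val y| ].

Arguments nonexpansive_maps {R H} C.

(* Main.v *)
Require Import Defs.
From HB Require Import structures.
From mathcomp Require Import all_boot all_order all_algebra sesquilinear.
From mathcomp Require Import all_classical all_reals all_analysis.
From mathcomp Require Import ring lra.

Set Implicit Arguments.
Unset Strict Implicit.
Unset Printing Implicit Defensive.

Import Order.TTheory GRing.Theory Num.Theory.
Import numFieldNormedType.Exports.

Local Open Scope classical_set_scope.
Local Open Scope ring_scope.

(** The set of all nonexpansive self-maps of [C] with a fixed point has a dense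
    interior, and this interior is the required open set.

    Translate a base point of [C] to the origin. Somewhat boundedness has one
    consequence on which everything rests: there are finitely many vectors
    [e] of norm at most 1 such that each point [x] of [C] of large norm has
    [c * `|x| <= dot x e] for one of them, with [c > 0] fixed
    ([coercive_functionals]). Hence the part of [C] on a large sphere is covered
    by finitely many convex slices [c * r <= dot x e]. If [y] is the point of
    such a slice nearest to the origin, then [`|y| >= c * r] and [dot x y >=
    `|y| ^+ 2] for [x] in the slice, so that [`|x - y| ^+ 2 <= r ^+ 2 - c ^+ 2
    * r ^+ 2] on the sphere; an almost nearest point serves as well
    ([almost_nearest_origin]). For every [L], if [r] is large enough, each point
    [x] of [C] outside the ball of radius [r] therefore satisfies [`|x - y| + L
    <= `|x|] for one of finitely many points [y] of [C]
    ([finite_cover_of_sphere]).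

    A nonexpansive [T] whose norm is at most [L] at those finitely many [y] has
    [`|T x| <= `|x - y| + `|T y| <= `|x|] for every [x] outside the ball. This
    is a boundary condition of Leray-Schauder type, and it forces a fixed point:
    the fixed points of the contractions [t *: T] stay bounded and converge as
    [t] tends to 1 ([fixed_point_of_coercive]). So the existence of a fixed
    point follows from a bound at finitely many points, which is an open
    condition for pointwise convergence ([finite_test_set]).

    For the density, compose [f] with the nearest point retraction onto the ball
    of radius [n] around the base point. The resulting maps are bounded, so they
    satisfy such a bound with strict inequality, and they converge pointwise to
    [f] because at each point they eventually agree with it. *)

(** * Inner product geometry *)

Section InnerProduct.
Context (R : realType) (H : normedModType R) (dot : {dot H for idfun}).
Context (dot_norm : induces_norm dot).
Implicit Types (x y z e : H) (D : set H).

Lemma dotC x y : dot x y = dot y x.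
Proof. by rewrite hermC /= expr0 mul1r. Qed.

Lemma dotDl x y z : dot (x + y) z = dot x z + dot y z.
Proof. exact: linearDl. Qed.

Lemma dotZl a x y : dot (a *: x) y = a * dot x y.
Proof. exact: linearZl_LR. Qed.

Lemma dotNl x y : dot (- x) y = - dot x y.
Proof. exact: linearNl. Qed.

Lemma dotDr x y z : dot x (y + z) = dot x y + dot x z.
Proof. exact: linearDr. Qed.

Lemma dotZr a x y : dot x (a *: y) = a * dot x y.
Proof. exact: linearZr_LR. Qed.

Lemma dotNr x y : dot x (- y) = - dot x y.
Proof. exact: linearNr. Qed.

Lemma dot0r x : dot x 0 = 0.
Proof. exact: linear0r. Qed.

Lemma sqr_normD x y : `|x + y| ^+ 2 = `|x| ^+ 2 + 2 * dot x y + `|y| ^+ 2.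
Proof.
by rewrite -!dot_norm dotDl !dotDr [dot y x]dotC; ring.
Qed.

Lemma sqr_normB x y : `|x - y| ^+ 2 = `|x| ^+ 2 - 2 * dot x y + `|y| ^+ 2.
Proof. by rewrite sqr_normD dotNr normrN; ring. Qed.

(** Cauchy-Schwarz, read off from the triangle inequality of the norm. *)
Lemma dot_le_norm x y : dot x y <= `|x| * `|y|.
Proof.
have : `|x + y| ^+ 2 <= (`|x| + `|y|) ^+ 2.
  by rewrite lerXn2r ?nnegrE ?addr_ge0 ?ler_normD.
by rewrite sqr_normD sqrrD -mulr_natr; lra.
Qed.

Lemma convex_combination D x y t : convex_set D -> D x -> D y ->
  0 <= t <= 1 -> D (t *: x + (1 - t) *: y).
Proof.
move=> cD Dx Dy /andP[t0 t1].
by have /(_ (mem_set Dx) (mem_set Dy))/set_mem := cD x y (Itv01 t0 t1).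
Qed.

Lemma convex_scale D x t : convex_set D -> D 0 -> D x -> 0 <= t <= 1 ->
  D (t *: x).
Proof.
by move=> cD D0 Dx /(convex_combination cD Dx D0); rewrite scaler0 addr0.
Qed.

(** The nearest point of the closed ball of radius [r]. *)
Definition radial (r : R) x := if `|x| <= r then x else (r / `|x|) *: x.

Lemma radial_id r x : `|x| <= r -> radial r x = x.
Proof. by rewrite /radial => ->. Qed.

Lemma radial_norm r x : 0 <= r -> `|radial r x| <= r.
Proof.
move=> r0; rewrite /radial; case: (leP `|x| r) => // rx.
by rewrite normrZ ger0_norm ?divr_ge0 // mulfVK // gt_eqF // (le_lt_trans r0).
Qed.

Lemma radial_mem D r x : convex_set D -> D 0 -> 0 <= r -> D x ->
  D (radial r x).
Proof.
move=> cD D0 r0 Dx; rewrite /radial; case: (leP `|x| r) => // rx.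
have x0 := le_lt_trans r0 rx.
by apply: convex_scale => //; rewrite divr_ge0 //= ler_pdivrMr // mul1r ltW.
Qed.

Lemma radial_obtuse r x z : 0 <= r -> `|z| <= r ->
  dot (x - radial r x) (z - radial r x) <= 0.
Proof.
move=> r0 zr; rewrite /radial; case: (leP `|x| r) => [_|rx].
  by rewrite subrr dotC dot0r.
have x0 := le_lt_trans r0 rx; set t := r / `|x|.
have tx : t * `|x| = r by rewrite mulfVK ?gt_eqF.
have t1 : t < 1 by rewrite ltr_pdivrMr // mul1r.
have -> : dot (x - t *: x) (z - t *: x) =
    (1 - t) * (dot x z - (t * `|x|) * `|x|).
  by rewrite dotDl !dotDr !dotNl !dotNr !dotZl !dotZr dot_norm; ring.
rewrite tx pmulr_rle0 ?subr_gt0 // subr_le0 (le_trans (dot_le_norm _ _)) //.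
by rewrite mulrC ler_wpM2r.
Qed.

(** Adding the two variational inequalities of the nearest points shows that
    the retraction is firmly nonexpansive. *)
Lemma radial_nonexpansive r x y : 0 <= r ->
  `|radial r x - radial r y| <= `|x - y|.
Proof.
move=> r0; have nr := radial_norm _ r0.
have := radial_obtuse x r0 (nr y); have := radial_obtuse y r0 (nr x).
move: (radial r x) (radial r y) => p q.
have [->|pq] := eqVneq p q; first by rewrite subrr normr0.
move=> Hy Hx.
have Hd : `|p - q| ^+ 2 <= dot (x - y) (p - q).
  move: Hx Hy; rewrite -dot_norm !dotDl !dotDr !dotNl !dotNr [dot q p]dotC; lra.
have := le_trans Hd (dot_le_norm _ _).
by rewrite expr2 ler_pM2r // normr_gt0 subr_eq0.
Qed.

End InnerProduct.

(** * Existence of fixed points *)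

Section FixedPoint.
Context (R : realType) (H : completeNormedModType R) (dot : {dot H for idfun}).
Context (dot_norm : induces_norm dot).
Context (D : set H) (D_convex : convex_set D) (D_closed : closed D) (D0 : D 0).
Context (T : H -> H) (T_mem : forall x, D x -> D (T x)).
Context (T_nonexp : forall x y, D x -> D y -> `|T x - T y| <= `|x - y|).

Lemma scaled_fixed_point (t : R) : 0 <= t < 1 ->
  exists2 x, D x & x = t *: T x.
Proof.
move=> /andP[t0 t1].
have tT_mem : {homo (fun x => t *: T x) : x / D x >-> D x}.
  by move=> x Dx; apply: convex_scale => //; [exact: T_mem|rewrite t0 ltW].
have [] := @banach_fixed_point R H D (mkfun tT_mem).
- exists (NngNum t0); split => //= -[x y] /= [Dx Dy].
  by rewrite -scalerBr normrZ ger0_norm // ler_wpM2l // T_nonexp.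
- exact: D_closed.
- by exists 0.
- by move=> x Dx xE; exists x.
Qed.

(** Monotonicity of [id - T] makes the curve of approximate fixed points
    [T x = (1 + p) x] satisfy this estimate, from which the norm increases as
    [p] decreases and norm convergence forces strong convergence. *)
Lemma approx_fixed_point_dist (p q : R) x y : 0 <= q < p ->
  D x -> D y -> T x = (1 + p) *: x -> T y = (1 + q) *: y ->
  `|x - y| ^+ 2 <= `|y| ^+ 2 - `|x| ^+ 2.
Proof.
move=> /andP[q0 qp] Dx Dy Tx Ty.
have : `|T x - T y| ^+ 2 <= `|x - y| ^+ 2.
  by rewrite lerXn2r ?nnegrE ?T_nonexp.
rewrite Tx Ty.
have -> : (1 + p) *: x - (1 + q) *: y = (x - y) + (p *: x - q *: y).
  by rewrite !scalerDl !scale1r opprD addrACA.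
rewrite (sqr_normD dot_norm) => h.
have {}h : dot (x - y) (p *: x - q *: y) <= 0.
  by have := sqr_ge0 `|p *: x - q *: y|; lra.
have dE := sqr_normB dot_norm x y.
have {}h : (p + q) * `|x - y| ^+ 2 <= (p - q) * (`|y| ^+ 2 - `|x| ^+ 2).
  move: h; rewrite dE !dotDl !dotDr !dotNl !dotNr !dotZr !dot_norm.
  rewrite [dot y x]dotC; lra.
have pq : 0 < p - q by rewrite subr_gt0.
move: h (sqr_ge0 `|x - y|); move: (`|y| ^+ 2 - _) (`|x - y| ^+ 2) => v d h d0.
have v0 : 0 <= v by rewrite -(pmulr_rge0 _ pq) (le_trans _ h) // mulr_ge0; lra.
rewrite -(@ler_pM2l _ (p + q)); last by lra.
apply: le_trans h _; rewrite ler_wpM2r //; lra.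
Qed.

(** The maps [(1 + p)^-1 *: T] have fixed points [u], and these stay bounded
    because [T u = (1 + p) *: u] contradicts [`|T u| <= `|u|] unless [u = 0].
    Their squared norms increase with [n], hence converge, and the
    estimate [approx_fixed_point_dist] turns this into convergence of the points. *)
Lemma fixed_point_of_coercive (r : R) :
  (forall x, D x -> r <= `|x| -> `|T x| <= `|x|) -> exists2 x, D x & T x = x.
Proof.
move=> Tr; pose p (n : nat) : R := n.+1%:R^-1.
have p0 n : 0 < p n by rewrite invr_gt0 ltr0n.
have /choice[u uP] n : exists x, D x /\ T x = (1 + p n) *: x.
  have p1 : 0 < 1 + p n by rewrite ltr_wpDl.
  have [|x Dx xE] := @scaled_fixed_point (1 + p n)^-1.
    by rewrite invr_ge0 ltW //= invf_lt1 // ltrDl.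
  by exists x; split=> //; rewrite {2}xE scalerA divff ?scale1r ?gt_eqF.
have Du n := (uP n).1; have Tu n := (uP n).2.
(* The value 0 covers the case of a nonpositive [r]. *)
have ur n : `|u n| <= Num.max r 0.
  have [ru|/ltW ur] := leP r `|u n|; last by rewrite le_max ur.
  have p1 : 0 <= 1 + p n by rewrite addr_ge0 // ltW.
  rewrite le_max; have := Tr _ (Du n) ru; rewrite Tu normrZ ger0_norm //.
  by rewrite mulrDl mul1r gerDl pmulr_rle0 // => ->; rewrite orbT.
have dist m n : (m <= n)%N -> `|u m - u n| ^+ 2 <= `|u n| ^+ 2 - `|u m| ^+ 2.
  rewrite leq_eqVlt => /orP[/eqP ->|mn]; first by rewrite !subrr normr0 expr0n.
  apply: approx_fixed_point_dist (Tu m) (Tu n) => //.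
  by rewrite ltW //= ltf_pV2 ?posrE ?ltr0n // ltr_nat.
have : cvgn (fun n => `|u n| ^+ 2).
  apply: nondecreasing_is_cvgn => [m n mn|].
    by have := le_trans (sqr_ge0 _) (dist _ _ mn); rewrite subr_ge0.
  exists (Num.max r 0 ^+ 2) => _ [n _ <-].
  by rewrite lerXn2r // nnegrE // le_max lexx orbT.
move=> /cauchy_cvgP/cauchy_ballP cau_n.
have : cvgn u.
  apply/cauchy_cvgP/cauchy_ballP => e e0.
  have := cau_n (e ^+ 2) (exprn_gt0 _ e0); rewrite !near_simpl => cau.
  apply: filterS cau => -[m n] /=; rewrite -!ball_normE /=.
  move=> mn; rewrite -(@ltr_pXn2r _ 2) ?nnegrE ?normr_ge0 ?ltW //.
  apply: le_lt_trans mn.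
  have [mn|/ltnW nm] := leqP m n.
    by rewrite [leRHS]distrC (le_trans (dist _ _ mn)) // ler_norm.
  by rewrite [X in X ^+ 2]distrC (le_trans (dist _ _ nm)) // ler_norm.
move=> uc; set l := limn u; have {}uc : u @ \oo --> l by [].
have Dl : D l by apply: (closed_cvg D) uc => //; exact: nearW.
exists l => //.
have Tuc : T (u n) @[n --> \oo] --> T l.
  apply/cvgrPdist_le => e e0; near=> n.
  apply: le_trans (T_nonexp Dl (Du n)) _.
  by near: n; move/cvgrPdist_le: uc; apply.
have : T (u n) @[n --> \oo] --> l.
  rewrite (funext Tu) -[X in _ --> X]scale1r -[X in _ --> X *: _]addr0.
  apply: cvgZ => //; apply: cvgD; first exact: cvg_cst.
  exact: cvg_harmonic.
by move=> /(cvg_unique _ Tuc); apply.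
Unshelve. all: by end_near. Qed.

End FixedPoint.

(** * Somewhat bounded sets *)

Section SomewhatBounded.
Context (R : realType) (H : normedModType R) (dot : {dot H for idfun}).
Context (dot_norm : induces_norm dot).
Implicit Types (x y z e : H) (D : set H) (s : seq H).

Lemma lin_span0 n (v : 'I_n -> H) : lin_span v 0.
Proof.
by exists (fun=> 0) => //; rewrite big1 // => i _; rewrite scale0r.
Qed.

Lemma lin_spanD n (v : 'I_n -> H) x y :
  lin_span v x -> lin_span v y -> lin_span v (x + y).
Proof.
move=> [a _ <-] [b _ <-]; exists (fun i => a i + b i) => //.
by rewrite -big_split; apply: eq_bigr => i _; rewrite scalerDl.
Qed.

Lemma lin_spanZ n (v : 'I_n -> H) a x : lin_span v x -> lin_span v (a *: x).
Proof.
move=> [b _ <-]; exists (fun i => a * b i) => //.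
by rewrite scaler_sumr; apply: eq_bigr => i _; rewrite scalerA.
Qed.

Lemma lin_span_gen n (v : 'I_n -> H) i : lin_span v (v i).
Proof.
exists (fun j => (j == i)%:R) => //.
rewrite (bigD1 i) //= eqxx scale1r big1 ?addr0 // => j /negPf ->.
by rewrite scale0r.
Qed.

Lemma orth_lin_span n (v : 'I_n -> H) z : (forall i, dot z (v i) = 0) ->
  orth_compl dot (lin_span v) z.
Proof.
move=> zv _ [c _ <-]; elim/big_ind: _ => [|x y zx zy|i _].
- exact: dot0r.
- by rewrite dotDr zx zy addr0.
- by rewrite dotZr zv mulr0.
Qed.

Definition proj s x := \sum_(e <- s) dot x e *: e.

Lemma proj_norm s x : {in s, forall e, `|e| <= 1} ->
  `|proj s x| <= \sum_(e <- s) `|dot x e|.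
Proof.
move=> s1; apply: le_trans (ler_norm_sum _ _ _) _.
rewrite big_seq [leRHS]big_seq; apply: ler_sum => e es.
by rewrite normrZ ler_piMr // s1.
Qed.

(** Gram-Schmidt. The induction processes the first [k] generators, and its
    third clause expresses by orthogonality that [proj s] takes values in the span
    of these. *)
Lemma gram_schmidt n (v : 'I_n -> H) : exists s,
  [/\ {in s, forall e, `|e| <= 1}, forall x, lin_span v (proj s x) &
      forall x, orth_compl dot (lin_span v) (x - proj s x)].
Proof.
suff /(_ n)[s [s1 sv _ sP]] : forall k, exists s,
    [/\ {in s, forall e, `|e| <= 1}, forall x, lin_span v (proj s x),
        forall z, (forall i : 'I_n, (i < k)%N -> dot z (v i) = 0) ->
          forall x, dot z (proj s x) = 0 &
        forall x (i : 'I_n), (i < k)%N -> dot (x - proj s x) (v i) = 0].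
  by exists s; split=> // x; apply: orth_lin_span => i; exact: sP.
elim=> [|k [s [s1 sv sz sP]]].
  exists [::]; split=> // [x|z _ x].
  - by rewrite /proj big_nil; exact: lin_span0.
  - by rewrite /proj big_nil dot0r.
have [kn|nk] := ltnP k n; last first.
  exists s; split=> // [z zv|x i _].
    by apply: sz => i ik; apply: zv; exact: ltnW.
  by apply: sP; exact: leq_trans (ltn_ord i) nk.
pose w := v (Ordinal kn); pose w' := w - proj s w.
have ltS (i : 'I_n) : (i < k.+1)%N -> (i < k)%N \/ v i = w.
  rewrite ltnS leq_eqVlt => /orP[/eqP ik|]; [right|by left].
  by congr v; exact: val_inj.
have w'v (i : 'I_n) : (i < k)%N -> dot w' (v i) = 0 by exact: sP.
have wE : w = w' + proj s w by rewrite subrK.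
have [w0|w0] := eqVneq w' 0.
  exists s; split=> // [z zv|x i /ltS[ik|->]].
  - by apply: sz => i ik; apply: zv; exact: ltnW.
  - exact: sP.
  - by rewrite wE w0 add0r sz // => j; exact: sP.
pose e := `|w'|^-1 *: w'.
have e1 : `|e| = 1 by rewrite normrZ normfV normr_id mulVf // normr_eq0.
have w'E : w' = `|w'| *: e by rewrite scalerA divff ?scale1r // normr_eq0.
have ev (i : 'I_n) : (i < k)%N -> dot e (v i) = 0.
  by move=> ik; rewrite dotZl w'v // mulr0.
have projE x : proj (e :: s) x = dot x e *: e + proj s x.
  by rewrite /proj big_cons.
exists (e :: s); split=> [f|x|z zv x|x i /ltS[ik|->]].
- by rewrite inE => /orP[/eqP -> |/s1 //]; rewrite e1.
- rewrite projE; apply: lin_spanD => //; do 2 apply: lin_spanZ.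
  rewrite /w' -scaleN1r; apply: lin_spanD; first exact: lin_span_gen.
  exact: lin_spanZ.
- have zs y : dot z (proj s y) = 0.
    by apply: sz => i ik; apply: zv; exact: ltnW.
  have zw : dot z w = 0 by exact: zv.
  have ze : dot z e = 0 by rewrite dotZr dotDr dotNr zs zw subr0 mulr0.
  by rewrite projE dotDr zs addr0 dotZr ze mulr0.
- rewrite projE opprD addrCA dotDl dotNl dotZl ev // mulr0 oppr0 add0r.
  exact: sP.
- have xe y : dot (x - proj (e :: s) x) (proj s y) = 0.
    apply: sz => j jk.
    rewrite projE opprD addrCA dotDl dotNl dotZl ev // mulr0 oppr0 add0r.
    exact: sP.
  rewrite wE dotDr xe addr0 w'E dotZr projE dotDl dotNl dotDl dotZl dot_norm.
  by rewrite e1 expr1n mulr1 [dot (proj s x) e]dotC (sz e) // addr0 subrr mulr0.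
Qed.

(** In the convex hull of [x] and of the point of the ball of [F] opposite to
    the projection [y] of [x], there is a multiple of [x - y]. It lies in the
    bounded section orthogonal to [F], so [x - y] grows at most linearly with
    [y], and some coordinate of [y] is comparable to the norm of [x]. *)
Lemma coercive_functionals D (F : set H) (alpha : R) :
  convex_set D -> findim_subspace F -> 0 < alpha ->
  [set alpha *: b | b in F `&` [set b | `|b| <= 1]] `<=` D ->
  bounded_set (orth_compl dot F `&` D) ->
  exists (c r0 : R) s, [/\ 0 < c, {in s, forall e, `|e| <= 1} &
    forall x, D x -> r0 <= `|x| -> exists2 e, e \in s & c * `|x| <= dot x e].
Proof.
move=> cD [n [v ->]] a0 aD /ex_strict_bound_gt0[M M0 MB].
have [s [s1 sv sP]] := gram_schmidt v.
have grow x : D x -> `|x| <= M + (1 + M / alpha) * `|proj s x|.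
  move=> Dx; set y := proj s x; set t := alpha / (alpha + `|y|).
  have ay : 0 < alpha + `|y| by rewrite ltr_wpDr.
  have t0 : 0 < t by rewrite divr_gt0.
  have tE : t * (alpha + `|y|) = alpha by rewrite mulfVK // gt_eqF.
  have Dz : D (t *: (x - y)).
    have Dy : D (alpha *: (- `|y|^-1 *: y)).
      apply: aD; exists (- `|y|^-1 *: y) => //; split.
        by apply: lin_spanZ; exact: sv.
      rewrite /= normrZ normrN normfV normr_id.
      by have [->|y0] := eqVneq `|y| 0; rewrite ?mulr0 // mulVf.
    have t1 : 0 <= t <= 1 by rewrite (ltW t0) /= ler_pdivrMr // mul1r lerDl.
    have := convex_combination cD Dx Dy t1.
    rewrite !scalerA scalerBr -scaleNr.
    have -> : (1 - t) * alpha * - `|y|^-1 *: y = - t *: y; last by [].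
    have [->|y0] := eqVneq y 0; first by rewrite !scaler0.
    have ny : `|y| != 0 by rewrite normr_eq0.
    have -> : (1 - t) * alpha = t * `|y|.
      by rewrite mulrBl mul1r -{1}tE mulrDr addrAC subrr add0r.
    by rewrite mulrN mulfK.
  have oz : orth_compl dot (lin_span v) (t *: (x - y)).
    by move=> z zv; rewrite dotZl sP // mulr0.
  have := MB _ (conj oz Dz) => /ltW; rewrite /= normrZ gtr0_norm // => tM.
  have : `|x - y| <= M / t by rewrite ler_pdivlMr // mulrC.
  have -> : M / t = M + M / alpha * `|y|.
    by rewrite /t; field; rewrite !gt_eqF.
  by have := ler_normD (x - y) y; rewrite subrK; lra.
(* Adjoining the opposite vectors removes the absolute values. The constant is
   chosen so that [K * (size s)%:R * c <= 1 / 2], which leaves the contradiction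
   [`|x| <= M + `|x| / 2]. *)
pose s' := s ++ [seq - e | e <- s].
pose K := 1 + M / alpha; have K0 : 0 < K by rewrite addr_gt0 // divr_gt0.
pose m : R := (size s)%:R; have m0 : 0 <= m by rewrite ler0n.
exists (2 * K * (m + 1))^-1, (2 * M + 1), s'; split.
- by rewrite invr_gt0 !mulr_gt0 // ltr_wpDl.
- move=> e; rewrite mem_cat => /orP[/s1 //|/mapP[f /s1 f1 ->]].
  by rewrite normrN.
- move=> x Dx xM; set c := _^-1; apply: contrapT => nex.
  have small e : e \in s -> `|dot x e| <= c * `|x|.
    move=> es; rewrite ler_norml; apply/andP; split.
      rewrite leNgt; apply/negP => lt; apply: nex; exists (- e).
        by rewrite mem_cat map_f ?orbT.
      by rewrite dotNr; lra.
    rewrite leNgt; apply/negP => lt; apply: nex; exists e; last exact: ltW.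
    by rewrite mem_cat es.
  have : `|proj s x| <= m * (c * `|x|).
    apply: le_trans (proj_norm x s1) _.
    rewrite mulr_natl; apply: (@le_trans _ _ (\sum_(e <- s) c * `|x|)).
      by rewrite big_seq [leRHS]big_seq; apply: ler_sum.
    by rewrite big_const_seq count_predT iter_addr_0.
  move: (grow _ Dx); rewrite -/K => gx px.
  have : `|x| <= M + K * (m * (c * `|x|)).
    by apply: le_trans gx _; rewrite lerD2l ler_wpM2l // ltW.
  have : K * (m * (c * `|x|)) = m / (m + 1) * (`|x| / 2).
    have mn : m + 1 != 0 by rewrite gt_eqF // ltr_wpDl.
    have Kn : K != 0 by rewrite gt_eqF.
    by rewrite /c; field; rewrite -/m mn Kn.
  have : m / (m + 1) * (`|x| / 2) <= `|x| / 2.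
    by rewrite ler_piMl ?divr_ge0 // ler_pdivrMr ?ltr_wpDl // mul1r lerDl.
  by lra.
Qed.

(** A point [y] of almost minimal norm in a convex set satisfies, up to a small
    error, the variational inequality [dot x y >= `|y| ^+ 2] of the nearest
    point: compare [y] with [y + t *: (x - y)] for a [t] so small that the second
    order term is negligible, after taking [y] minimal up to a fraction of [t]. *)
Lemma almost_nearest_origin (K : set H) (r eps : R) z : convex_set K ->
  K z -> `|z| <= r -> 0 < eps -> exists2 y, K y &
    forall x, K x -> `|x| <= r -> `|x - y| ^+ 2 <= `|x| ^+ 2 - `|y| ^+ 2 + eps.
Proof.
move=> cK Kz zr eps0; have r0 : 0 <= r := le_trans (normr_ge0 z) zr.
pose E := [set `|x| ^+ 2 | x in K].
have lbE : lbound E 0 by move=> _ [x _ <-]; exact: sqr_ge0.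
have infE : has_inf E by split; [exists (`|z| ^+ 2), z|exists 0].
have infP x : K x -> inf E <= `|x| ^+ 2.
  by move=> Kx; apply: ge_inf; [exists 0|exists x].
(* [B] bounds the squared distance from [y] to the points of [K] in the ball,
   and [t] is such that [t * B <= eps / 2]. *)
pose B := (2 * r + 1) ^+ 2; have B0 : 0 <= B by exact: sqr_ge0.
pose t := eps / (2 * (B + eps)).
have Be : 0 < B + eps by rewrite ltr_wpDl.
have t0 : 0 < t by rewrite divr_gt0 // mulr_gt0.
have tE : t * (2 * (B + eps)) = eps.
  by rewrite /t mulfVK // gt_eqF // mulr_gt0.
have t01 : 0 <= t <= 1.
  by rewrite (ltW t0) /= ler_pdivrMr ?mulr_gt0 //; lra.
pose eta := Num.min 1 (t * (eps / 2)).
have eta0 : 0 < eta by rewrite lt_min ltr01 mulr_gt0 // divr_gt0.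
have [_ [y Ky <-] yE] := inf_adherent eta0 infE.
exists y => // x Kx xr.
have y2 : `|y| ^+ 2 <= r ^+ 2 + 1.
  have := infP _ Kz; have : `|z| ^+ 2 <= r ^+ 2 by rewrite lerXn2r ?nnegrE.
  have : eta <= 1 by rewrite ge_min lexx.
  by lra.
have yr : `|y| <= r + 1.
  rewrite -(@ler_pXn2r _ 2) ?nnegrE ?addr_ge0 //; apply: le_trans y2 _.
  by rewrite sqrrD1; nra.
have xyB : `|x - y| ^+ 2 <= B.
  rewrite lerXn2r ?nnegrE //; first by lra.
  by rewrite (le_trans (ler_normB _ _)) //; lra.
have Kt : K (y + t *: (x - y)).
  have := convex_combination cK Kx Ky t01.
  by congr K; rewrite scalerBr scalerBl scale1r addrCA.
have := infP _ Kt; rewrite (sqr_normD dot_norm) dotZr normrZ exprMn.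
rewrite (ger0_norm (ltW t0)) => h1.
have h2 : eta <= t * (eps / 2) by rewrite ge_min lexx orbT.
have h3 : t * (- 2 * dot y (x - y)) <= t * eps.
  have : t ^+ 2 * `|x - y| ^+ 2 <= t * (eps / 2).
    rewrite expr2 -mulrA ler_pM2l //; apply: (@le_trans _ _ (t * B)).
      by rewrite ler_pM2l.
    by move: tE; rewrite mulrCA mulrDr; have := mulr_gt0 t0 eps0; lra.
  by move: h1 yE h2; lra.
move: h3; rewrite ler_pM2l // dotDr dotNr dot_norm => h3.
by rewrite (sqr_normB dot_norm) [dot x y]dotC; lra.
Qed.

(** Each functional [e] cuts from the sphere of radius [r] the points of the
    convex slice [c * r <= dot x e], to which [almost_nearest_origin] applies
    with half of the gain [(c * r) ^+ 2] as error. Points beyond the sphere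
    reduce to it: their radial projection to the sphere, at distance [`|x| - r],
    lies in [D] because [D] is star-shaped about 0. *)
Lemma finite_cover_of_sphere D (c r0 : R) s (L : R) :
  convex_set D -> D 0 -> 0 < c -> {in s, forall e, `|e| <= 1} ->
  (forall x, D x -> r0 <= `|x| ->
     exists2 e, e \in s & c * `|x| <= dot x e) -> 0 <= L ->
  exists (r : R) (ys : seq H), {in ys, forall y, D y} /\
    forall x, D x -> r <= `|x| -> exists2 y, y \in ys & `|x - y| + L <= `|x|.
Proof.
move=> cD D0 c0 s1 sD L0.
(* The third term gives [r ^+ 2 - (c * r) ^+ 2 / 2 <= (r - L) ^+ 2]. *)
pose r := `|r0| + L + 4 * L / c ^+ 2 + 1.
have c2 : 0 < c ^+ 2 by rewrite exprn_gt0.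
have Lc : 0 <= 4 * L / c ^+ 2 by rewrite divr_ge0 ?mulr_ge0 // ltW.
have r0r : r0 <= r by have := ler_norm r0; rewrite /r; lra.
have Lr : L < r by have := normr_ge0 r0; rewrite /r; lra.
have rpos : 0 < r by apply: le_lt_trans Lr.
have cr : 4 * L <= c ^+ 2 * r.
  by rewrite [leRHS]mulrC -ler_pdivrMr // /r; have := normr_ge0 r0; lra.
(* For a slice that misses the sphere, 0 is a dummy value. *)
have /choice[y yP] e : exists y, D y /\ (`|e| <= 1 ->
    forall x, D x -> `|x| = r -> c * r <= dot x e -> `|x - y| + L <= r).
  pose K := [set x | D x /\ c * r <= dot x e].
  have [[z [[Dz ze] zr]]|none] := pselect (exists z, K z /\ `|z| = r);
    last first.
    by exists 0; split=> // _ x Dx xr xe; exfalso; apply: none; exists x.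
  have cK : convex_set K.
    move=> x x' t /set_mem[Dx xe] /set_mem[Dx' xe']; apply/mem_set; split.
      by apply/set_mem; apply: cD; exact: mem_set.
    rewrite /conv /= dotDl !dotZl.
    have t0 : 0 <= t%:num by [].
    have t1 : 0 <= 1 - t%:num by rewrite subr_ge0.
    have := ler_wpM2l t0 xe; have := ler_wpM2l t1 xe'.
    by rewrite /unstable.onem; lra.
  have eps0 : 0 < (c * r) ^+ 2 / 2 by rewrite divr_gt0 // exprn_gt0 // mulr_gt0.
  have zle : `|z| <= r by rewrite zr.
  have [y [Dy ye] yP] := almost_nearest_origin cK (conj Dz ze) zle eps0.
  exists y; split=> // e1 x Dx xr xe; rewrite -lerBrDr.
  have ny : c * r <= `|y|.
    apply: le_trans ye _; apply: le_trans (dot_le_norm dot_norm _ _) _.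
    by rewrite ler_piMr.
  have ny2 : (c * r) ^+ 2 <= `|y| ^+ 2.
    by rewrite lerXn2r ?nnegrE // mulr_ge0 // ltW.
  rewrite -(@ler_pXn2r _ 2) ?nnegrE ?subr_ge0 ?(ltW Lr) //.
  have := yP x (conj Dx xe); rewrite xr lexx => /(_ isT) h.
  apply: le_trans h _.
  have : 4 * L * r <= (c * r) ^+ 2.
    by rewrite exprMn [r ^+ 2]expr2 mulrA ler_wpM2r // ltW.
  by have := sqr_ge0 L; rewrite sqrrB -mulr_natr; lra.
exists r, [seq y e | e <- s]; split=> [_ /mapP[e _ ->]|x Dx rx].
  exact: (yP e).1.
have x0 : 0 < `|x| := lt_le_trans rpos rx.
pose x' := (r / `|x|) *: x.
have Dx' : D x'.
  apply: convex_scale => //.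
  by rewrite divr_ge0 ?(ltW rpos) //= ler_pdivrMr // mul1r.
have x'r : `|x'| = r.
  by rewrite normrZ ger0_norm ?divr_ge0 ?(ltW rpos) // mulfVK // gt_eqF.
have [|e es xe] := sD x' Dx'; first by rewrite x'r.
exists (y e); first exact: map_f.
have := (yP e).2 (s1 _ es) x' Dx' x'r; rewrite -{1}x'r => /(_ xe) h.
have xx' : `|x - x'| = `|x| - r.
  rewrite -{1}[x]scale1r -scalerBl normrZ ger0_norm; last first.
    by rewrite subr_ge0 ler_pdivrMr // mul1r.
  by rewrite mulrBl mul1r mulfVK // gt_eqF.
by have := ler_distD x' x (y e); rewrite xx'; lra.
Qed.

End SomewhatBounded.

(** * Stability of fixed points *)

Lemma set_val_inj (T : Type) (A : set T) : injective (set_val : A -> T).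
Proof. by move=> x y; rewrite set_valE => /val_inj. Qed.

Section Stability.
Context (R : realType) (H : completeNormedModType R) (dot : {dot H for idfun}).
Context (dot_norm : induces_norm dot).

Definition fixes_if_bounded_on (D : set H) (L : R) (ys : seq H) :=
  forall T : H -> H, (forall x, D x -> D (T x)) ->
  (forall x y, D x -> D y -> `|T x - T y| <= `|x - y|) ->
  {in ys, forall y, `|T y| <= L} -> exists2 x, D x & T x = x.

(** The test points are those of [finite_cover_of_sphere] for the same [L]:
    [`|T x| <= `|x - y| + `|T y|], and the covering leaves room for [`|T y|]. *)
Lemma finite_test_set (D F : set H) (alpha L : R) :
  convex_set D -> closed D -> D 0 -> findim_subspace F -> 0 < alpha ->
  [set alpha *: b | b in F `&` [set b | `|b| <= 1]] `<=` D ->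
  bounded_set (orth_compl dot F `&` D) -> 0 <= L ->
  exists2 ys : seq H, {in ys, forall y, D y} & fixes_if_bounded_on D L ys.
Proof.
move=> cD clD D0 Ff a0 aD bD L0.
have [c [r0 [s [c0 s1 sD]]]] := coercive_functionals dot_norm cD Ff a0 aD bD.
have [r [ys [ysD ysr]]] := finite_cover_of_sphere dot_norm cD D0 c0 s1 sD L0.
exists ys => // T TD T1 TL.
apply: (fixed_point_of_coercive dot_norm cD clD D0 TD T1 (r := r)) => x Dx rx.
have [y yys xyL] := ysr x Dx rx.
apply: le_trans xyL; rewrite -[T x](subrK (T y)).
apply: le_trans (ler_normD _ _) _; rewrite lerD ?TL //.
by apply: T1 => //; exact: ysD.
Qed.

Context (C : set H) (C_convex : convex_set C).

Context (x0 : C).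

Lemma translate_mem (z : H) :
  [set x - set_val x0 | x in C] z <-> C (z + set_val x0).
Proof.
split=> [[x Cx <-]|Cz]; first by rewrite subrK.
by exists (z + set_val x0) => //; rewrite addrK.
Qed.

Lemma translate_convex : convex_set [set x - set_val x0 | x in C].
Proof.
move=> x y t /set_mem/translate_mem Cx /set_mem/translate_mem Cy.
apply/mem_set/translate_mem.
have /set_mem := C_convex t (mem_set Cx) (mem_set Cy); congr C.
rewrite /conv /= !scalerDr addrACA -scalerDl /unstable.onem.
by rewrite [t%:num + _]addrC subrK scale1r.
Qed.

Lemma translate0 : [set x - set_val x0 | x in C] 0.
Proof. by apply/translate_mem; rewrite add0r; exact: set_valP. Qed.

Lemma translate_closed : closed C -> closed [set x - set_val x0 | x in C].
Proof.
move=> clC; rewrite (_ : image _ _ = (fun z => z + set_val x0) @^-1` C).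
  by apply: closed_comp => // z _; apply: cvgD; [exact: cvg_id|exact: cvg_cst].
by apply/seteqP; split=> z /translate_mem.
Qed.

(** The test set of [finite_test_set], transported to [C] by the translation
    which puts [x0] at the origin. *)
Lemma finite_test_set_maps (F : set H) (alpha L : R) :
  let D := [set x - set_val x0 | x in C] in
  closed C -> findim_subspace F -> 0 < alpha ->
  [set alpha *: b | b in F `&` [set b | `|b| <= 1]] `<=` D ->
  bounded_set (orth_compl dot F `&` D) -> 0 <= L ->
  exists ys : seq C, forall f : nonexpansive_maps C,
    {in ys, forall y, `|set_val (set_val f y) - set_val x0| <= L} ->
    exists x : C, set_val f x = x.
Proof.
move=> D clC Ff a0 aD bD L0.
have [ys ysD ysP] := finite_test_set translate_convex
  (translate_closed clC) translate0 Ff a0 aD bD L0.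
pose lift z : C := insubd x0 (z + set_val x0).
have liftK z : D z -> set_val (lift z) = z + set_val x0.
  by move=> /translate_mem/mem_set Cz; rewrite set_valE insubdK.
exists [seq lift y | y <- ys] => f fL.
pose T z := set_val (set_val f (lift z)) - set_val x0.
have [x Dx|x y Dx Dy|y yys|x Dx Tx] := ysP T.
- by apply/translate_mem; rewrite /T subrK; exact: set_valP.
- rewrite /T opprB addrA subrK.
  have := set_valP f; rewrite /nonexpansive_maps /= => /(_ (lift x) (lift y)).
  by move=> /le_trans -> //; rewrite !liftK // opprD addrACA subrr addr0.
- by apply: fL; exact: map_f.
- exists (lift x); apply: set_val_inj; rewrite liftK //.
  by rewrite -{2}Tx /T subrK.
Qed.

Lemma ball_retraction (r : R) : 0 <= r -> exists rho : C -> C,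
  [/\ forall x y,
        `|set_val (rho x) - set_val (rho y)| <= `|set_val x - set_val y|,
      forall x, `|set_val x - set_val x0| <= r -> rho x = x &
      forall x, `|set_val (rho x) - set_val x0| <= r].
Proof.
move=> r0.
have /choice[rho rhoE] (x : C) : exists x' : C,
    set_val x' = radial r (set_val x - set_val x0) + set_val x0.
  have /translate_mem Cx : [set x - set_val x0 | x in C]
      (radial r (set_val x - set_val x0)).
    apply: radial_mem => //; [exact: translate_convex|exact: translate0|].
    by apply/translate_mem; rewrite subrK; exact: set_valP.
  by exists (SigSub (mem_set Cx)).
exists rho; split=> [x y|x xr|x].
- rewrite !rhoE opprD addrACA subrr addr0.
  apply: le_trans (radial_nonexpansive dot_norm _ _ r0) _.
  by rewrite opprB addrA subrK.
- by apply: set_val_inj; rewrite rhoE radial_id // subrK.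
- by rewrite rhoE addrK radial_norm.
Qed.

Lemma retraction_nonexpansive (f : nonexpansive_maps C) (rho : C -> C) :
  (forall x y,
    `|set_val (rho x) - set_val (rho y)| <= `|set_val x - set_val y|) ->
  nonexpansive_maps C (set_val f \o rho).
Proof. by move=> rho1 x y; apply: le_trans (set_valP f _ _) (rho1 _ _). Qed.

End Stability.

(** * Pointwise topology *)

Lemma eval_continuous (R : realType) (H : normedModType R) (C : set H) (y : C) :
  continuous (fun f : nonexpansive_maps C => set_val (set_val f y)).
Proof.
move=> f.
have c1 : {for f, continuous (set_val : nonexpansive_maps C -> {ptws C -> C})}.
  exact: initial_continuous.
have c2 : {for set_val f, continuous (fun h : {ptws C -> C} => h y)}.
  exact: proj_continuous.
have c3 : {for set_val f y, continuous (set_val : C -> H)}.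
  exact: initial_continuous.
exact: (continuous_comp (continuous_comp c1 c2) c3).
Qed.

Lemma near_bounded_on (R : realType) (H : normedModType R) (C : set H)
    (f : nonexpansive_maps C) (c : H) (L : R) (ys : seq C) :
  {in ys, forall y, `|set_val (set_val f y) - c| < L} ->
  \forall h \near f, {in ys, forall y, `|set_val (set_val h y) - c| <= L}.
Proof.
have ff : Filter (nbhs f) := nbhs_filter f.
elim: ys => [_|y ys IH fL]; first by apply: (@nearW _ (nbhs f)) => h z.
have {IH} := IH (fun z zys => fL z (mem_behead (s := y :: ys) zys)).
have yL : \forall h \near f, `|set_val (set_val h y) - c| < L.
  apply: (@eval_continuous _ _ _ y f [set z | `|z - c| < L]).
  have : open [set z : H | `|z - c| < L].
    have -> : [set z : H | `|z - c| < L] = ball c L.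
      by rewrite -ball_normE; apply/seteqP; split=> z /=; rewrite distrC.
    exact: ball_open.
  move=> oL; apply: open_nbhs_nbhs; split=> //=.
  by apply: fL; rewrite mem_head.
apply: filterS2 yL => h hy hys z.
by rewrite inE => /orP[/eqP ->|/hys //]; exact: ltW.
Qed.

Lemma cvg_nonexpansive_maps (R : realType) (H : normedModType R) (C : set H)
    (g : nat -> nonexpansive_maps C) (f : nonexpansive_maps C) :
  (forall x, \forall n \near \oo, set_val (g n) x = set_val f x) ->
  g @ \oo --> f.
Proof.
move=> gf.
have gv : (set_val \o g) @ \oo --> (set_val f : {ptws C -> C}).
  apply/pointwise_cvgP => x A /nbhs_singleton Af.
  by apply: filterS (gf x) => n /= ->.
move=> A /= [B [[V oV <-] /= Vf] BA].
have : nbhs (set_val f : {ptws C -> C}) V by apply: open_nbhs_nbhs.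
move=> /gv [N _ NV]; exists N => // n /NV Vn; exact: BA.
Qed.

Theorem theorem3p4 (R : realType) (H : completeNormedModType R)
    (dot : {dot H for idfun}) (dot_norm : induces_norm dot)
    (H_separable : separable H) (H_infinite : infinite_dimensional H)
    (C : set H) (C_closed : closed C) (C_convex : convex_set C)
    (C_somewhat_bounded : somewhat_bounded dot C) :
  exists U : set (nonexpansive_maps C),
    [/\ open U, dense U &
      forall f : nonexpansive_maps C, U f -> exists x : C, set_val f x = x].
Proof.
have [_ _ _ [x0' [F [alpha [Cx0 Ff alpha0 ballD boundedD]]]]] :=
  C_somewhat_bounded.
pose x0 : C := SigSub (mem_set Cx0).
have x0E : x0' = set_val x0 by rewrite set_valE.
rewrite {}x0E in ballD boundedD.
pose P := [set f : nonexpansive_maps C | exists x : C, set_val f x = x].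
exists P^°; split; [exact: open_interior| |exact: interior_subset].
move=> O [f Of] oO.
have /choice[rho rhoP] n := ball_retraction dot_norm C_convex x0 (ler0n R n).
have rho1 n := let: And3 h _ _ := rhoP n in h.
have rho_id n := let: And3 _ h _ := rhoP n in h.
have rho_le n := let: And3 _ _ h := rhoP n in h.
pose g n : nonexpansive_maps C :=
  SigSub (mem_set (retraction_nonexpansive f (rho1 n))).
have gf : g @ \oo --> f.
  apply: cvg_nonexpansive_maps => x; near=> n.
  rewrite set_valE /= rho_id //; near: n; exact: nbhs_infty_ger.
have [N _ gO] : \forall n \near \oo, O (g n).
  by apply: gf; exact: open_nbhs_nbhs.
exists (g N); split; first by apply: gO => /=.
(* [g N] is bounded by [N%:R] plus the displacement of [x0], and the added 1
   leaves room for its neighbours. *)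
pose L : R := N%:R + `|set_val (set_val f x0) - set_val x0| + 1.
have L0 : 0 <= L by rewrite !addr_ge0.
have [ys ysP] :=
  finite_test_set_maps dot_norm C_convex C_closed Ff alpha0 ballD boundedD L0.
have : \forall h \near g N,
    {in ys, forall y, `|set_val (set_val h y) - set_val x0| <= L}.
  apply: near_bounded_on => y _.
  apply: le_lt_trans (ler_distD (set_val (set_val f x0)) _ _) _.
  rewrite /L -addrA ler_ltD // ?ltrDl //.
  apply: le_trans (rho_le N y); exact: (set_valP f _ x0).
by apply: filterS => h; exact: ysP.
Unshelve. all: by end_near. Qed.
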